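(* Let $\mathrm{M}$ be a matroid of positive rank $d$ on a finite set $E$, and let $w=(w_e)_{e\in E}$ be positive real weights. Let $\mathrm{B}$ be a random basis of $\mathrm{M}$ with $\mathbb{P}(\mathrm{B}=b)$ proportional to $\prod_{e\in b} w_e$ for each basis $b$. Then for any distinct free elements $i,j\in E$, \[ \mathbb{P}(i \in \mathrm{B}, j \in \mathrm{B})\ \mathbb{P}(i \notin \mathrm{B}, j \notin \mathrm{B}) \le \Big(1-\frac{1}{d}\Big)\ \mathbb{P}(i \in \mathrm{B}, j \notin \mathrm{B})\ \mathbb{P}(i \notin \mathrm{B}, j \in \mathrm{B}). \]
   Context: An element $e$ of a rank $d$ matroid is a coloop if it lies in every basis, and is called free if it is not a coloop and every circuit (minimal dependent set) containing $e$ has cardinality $d+1$. *)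

(* Defs.v *)
From HB Require Import structures.
From mathcomp Require Import all_boot all_order all_algebra.
From mathcomp Require Import reals.

Set Implicit Arguments.
Unset Strict Implicit.
Unset Printing Implicit Defensive.

Import Order.TTheory GRing.Theory Num.Theory.

Record matroid (E : finType) := Matroid {
  bases : {set {set E}};
  bases_neq0 : bases != set0;
  bases_exchange : forall (b1 b2 : {set E}) (x : E),
    b1 \in bases -> b2 \in bases -> x \in b1 :\: b2 ->
    exists2 y, y \in b2 :\: b1 & y |: (b1 :\ x) \in bases
}.

Section Matroid.

Variables (E : finType) (M : matroid E).
Implicit Types (e : E) (A b C : {set E}).

(* All bases have the same cardinality: see [card_basis]. *)
Definition matroid_rank : nat := \max_(b in bases M) #|b|.

Definition indep A : bool := [exists b in bases M, A \subset b].

Definition circuit C : bool := minset (fun A => ~~ indep A) C.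

Definition coloop e : Prop := forall b, b \in bases M -> e \in b.

Definition free_element e : Prop :=
  ~ coloop e /\
  forall C, circuit C -> e \in C -> #|C| = (matroid_rank + 1)%N.

Lemma leq_card_bases b1 b2 :
  b1 \in bases M -> b2 \in bases M -> #|b1| <= #|b2|.
Proof.
have [n] := ubnP #|b1 :\: b2|; elim: n b1 => // n IHn b1 ltn Mb1 Mb2.
have [b12|/subsetPn[x xb1 xNb2]] := boolP (b1 \subset b2).
  exact: subset_leq_card.
have xD : x \in b1 :\: b2 by rewrite inE xNb2.
have [y yD Mb] := bases_exchange Mb1 Mb2 xD.
have /andP[yNb1 yb2] : (y \notin b1) && (y \in b2) by rewrite inE in yD.
have <- : #|y |: (b1 :\ x)| = #|b1|.
  by rewrite cardsU1 !inE (negbTE yNb1) andbF /= (cardsD1 x b1) xb1.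
apply: IHn => //; rewrite ltnS in ltn; apply: leq_trans ltn.
apply/proper_card/properP; split; last first.
  exists x; rewrite // !inE eqxx xNb2 /= orbF.
  by apply: contraNneq xNb2 => ->.
apply/subsetP => z; rewrite !inE => /andP[zNb2 /predU1P[zy|/andP[_ ->]]].
  by rewrite zy yb2 in zNb2.
by rewrite zNb2.
Qed.

Lemma card_basis b : b \in bases M -> #|b| = matroid_rank.
Proof.
move=> Mb; apply/eqP; rewrite eqn_leq leq_bigmax_cond //=.
by apply/bigmax_leqP => b' Mb'; exact: leq_card_bases.
Qed.

Local Open Scope ring_scope.

Variables (R : realType) (w : E -> R).

Definition basis_weight b : R := \prod_(e in b) w e.

(* The law of the random basis: the probability mass function on subsets of E
   that is supported on the bases and proportional to [basis_weight] there. *)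
Definition basis_pmf b : R :=
  if b \in bases M
  then basis_weight b / \sum_(b' in bases M) basis_weight b' else 0.

Definition basis_prob (A : pred {set E}) : R := \sum_(b | A b) basis_pmf b.

Lemma basis_pmf_sum1 : (forall e, 0 < w e) -> \sum_b basis_pmf b = 1.
Proof.
move=> w0; rewrite -big_mkcond /= -mulr_suml divff // gt_eqF //.
have wt0 b : 0 < basis_weight b by exact: prodr_gt0.
have [b Mb] := set0Pn _ (bases_neq0 M).
rewrite (bigD1 b) //= ltr_pwDl // sumr_ge0 // => b' _; exact: ltW.
Qed.

End Matroid.

(* Main.v *)
(** Let [N] be the restriction of [M] to the elements other than [i] and [j],
and let [I_k] be the weighted sum of the independent sets of [N] of size [k].
Since [i] and [j] are free, up to the factors [w i] and [w j] the four
probabilities are [I_(d-2)], [I_d], [I_(d-1)], [I_(d-1)] (the first two being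
upper bounds and the last two lower bounds), so that the claim is Mason's
inequality [d I_(d-2) I_d <= (d-1) I_(d-1)^2].

It follows from the Hodge-Riemann property of the homogeneous polynomial
[F = \sum_A w^A t^(m-|A|) / (m-|A|)!], [A] running over the independent sets:
its Hessian at a positive point has exactly one positive eigenvalue.  Partial
derivatives of [F] are polynomials of the same kind for contractions, so one
inducts on the degree.  By Euler's identity the Hessian of [F] is a positive
combination of those of its derivatives, and their Hodge-Riemann property
gives [A <= A^2] for the Hessian [A] normalized to fix the constant vector;
as [A <= 1] by a graph Laplacian argument, with equality only on constants, [A]
is nonpositive on the orthogonal complement of the constants.  Letting [t]
tend to 0 in the resulting inequality gives Mason's. *)

Require Import Defs.
From mathcomp Require Import all_boot all_order all_algebra.
From mathcomp Require Import reals.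
From mathcomp Require Import ring lra zify.

Set Implicit Arguments.
Unset Strict Implicit.
Unset Printing Implicit Defensive.

Import Order.TTheory GRing.Theory Num.Theory.
Local Open Scope ring_scope.

(** * Weighted graph Laplacians *)

Lemma injective_system_solvable (F : fieldType) (I : finType)
    (K : I -> I -> F) :
  (forall v, (forall u, \sum_j K u j * v j = 0) -> forall u, v u = 0) ->
  forall b, exists z, forall u, \sum_j K u j * z j = b u.
Proof.
move=> injK b.
pose A := \matrix_(j < #|I|, u < #|I|) K (enum_val u) (enum_val j).
have mulAE (z : 'rV_#|I|) u :
    (z *m A) 0 (enum_rank u) = \sum_j K u j * z 0 (enum_rank j).
  rewrite mxE (reindex enum_rank) /=; last exact/onW_bij/enum_rank_bij.
  by apply: eq_bigr => j _; rewrite mxE !enum_rankK mulrC.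
have Aunit : A \in unitmx.
  rewrite -row_free_unit; apply: inj_row_free => v vA0.
  apply/rowP => r; rewrite mxE -(enum_valK r).
  apply: (injK (fun j => v 0 (enum_rank j))) => u.
  by rewrite -mulAE vA0 mxE.
pose bb : 'rV_#|I| := \row_r b (enum_val r).
exists (fun j => (bb *m invmx A) 0 (enum_rank j)) => u.
by rewrite -mulAE mulmxKV // mxE enum_rankK.
Qed.

Section Laplacian.
Variables (R : realFieldType) (I : finType) (K : I -> I -> R).
Hypothesis Ksym : forall u v, K u v = K v u.
Hypothesis K_ge0 : forall u v, 0 <= K u v.

Let k u := \sum_v K u v.
Let ap (p : I -> R) u := \sum_v K u v * p v.

Lemma ap_dotC p q : \sum_u p u * ap q u = \sum_u q u * ap p u.
Proof.
under eq_bigr do rewrite mulr_sumr.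
rewrite exchange_big; apply: eq_bigr => v _; rewrite mulr_sumr.
by apply: eq_bigr => u _; rewrite Ksym; ring.
Qed.

Lemma ap_dot1 p : \sum_u ap p u = \sum_u k u * p u.
Proof.
rewrite exchange_big; apply: eq_bigr => v _; rewrite mulr_suml.
by apply: eq_bigr => u _; rewrite Ksym.
Qed.

(** Dirichlet form of [D - K], where [D] is the diagonal of the row sums [k]; every unordered pair
    is met twice, whence the factor 2. *)
Lemma laplacianE p :
  \sum_u \sum_v K u v * (p u - p v) ^+ 2 =
  (\sum_u k u * p u ^+ 2 - \sum_u p u * ap p u) *+ 2.
Proof.
have E1 : \sum_u \sum_v K u v * p u ^+ 2 = \sum_u k u * p u ^+ 2.
  by apply: eq_bigr => u _; rewrite mulr_suml.
have E2 : \sum_u \sum_v K u v * p v ^+ 2 = \sum_u k u * p u ^+ 2.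
  rewrite exchange_big -E1; apply: eq_bigr => u _; apply: eq_bigr => v _.
  by rewrite Ksym.
have E3 : \sum_u \sum_v K u v * (p u * p v) = \sum_u p u * ap p u.
  apply: eq_bigr => u _; rewrite mulr_sumr.
  by apply: eq_bigr => v _; ring.
have -> : \sum_u \sum_v K u v * (p u - p v) ^+ 2 =
    \sum_u \sum_v K u v * p u ^+ 2 + \sum_u \sum_v K u v * p v ^+ 2
    - (\sum_u \sum_v K u v * (p u * p v)) *+ 2.
  rewrite -sumrMnl -!big_split -sumrB; apply: eq_bigr => u _ /=.
  rewrite -sumrMnl -!big_split -sumrB; apply: eq_bigr => v _ /=.
  by ring.
by rewrite E1 E2 E3; ring.
Qed.

Lemma laplacian_ge0 p : \sum_u p u * ap p u <= \sum_u k u * p u ^+ 2.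
Proof.
rewrite -subr_ge0 -(pmulrn_lge0 _ (ltn0Sn 1)) -laplacianE.
by do 2!(apply: sumr_ge0 => ? _); rewrite mulr_ge0 ?sqr_ge0.
Qed.

Let k_ge0 u : 0 <= k u. Proof. exact: sumr_ge0. Qed.

Lemma weight_eq0 u v : k u = 0 -> K u v = 0.
Proof. by move/psumr_eq0P => -> //. Qed.

Lemma weighted_sum_eq0 (p : I -> R) : \sum_u k u = 0 -> \sum_u k u * p u = 0.
Proof. by move/psumr_eq0P => k0; apply: big1 => u _; rewrite k0 ?mul0r. Qed.

(** Connectedness in its simplest form: the support of [k] is a star centred at [o], so a vanishing
    Dirichlet form forces constancy there. *)
Variable o : I.
Hypothesis star_o : forall u, k u != 0 -> 0 < K o u.

Lemma laplacian_eq0 p :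
  \sum_u p u * ap p u = \sum_u k u * p u ^+ 2 ->
  forall u, k u != 0 -> p u = p o.
Proof.
move=> eq0 u ku; have := laplacianE p; rewrite eq0 subrr mul0rn.
move/psumr_eq0P => /(_ _ o isT) Lo.
have {Lo} : \sum_v K o v * (p o - p v) ^+ 2 = 0.
  by apply: Lo => v _; apply: sumr_ge0 => ? _; rewrite mulr_ge0 ?sqr_ge0.
move/psumr_eq0P => /(_ _ u isT) Lou.
have /eqP : K o u * (p o - p u) ^+ 2 = 0.
  by apply: Lou => v _; rewrite mulr_ge0 ?sqr_ge0.
by rewrite mulf_eq0 gt_eqF ?star_o //= sqrf_eq0 subr_eq0 => /eqP.
Qed.

(* [D - K] has kernel spanned by the constants on the support of [k]; adding
   the rank one term and the identity off the support makes it invertible. *)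
Lemma laplacian_solvable y : \sum_u k u * y u = 0 ->
  exists z, forall u, ap z u = k u * (z u - y u).
Proof.
move=> y0.
pose B u v := (if u == v then k u + (k u == 0)%:R else 0) - K u v + k u * k v.
have BE z u : \sum_v B u v * z v =
    (k u + (k u == 0)%:R) * z u - ap z u + k u * \sum_v k v * z v.
  have -> : \sum_v B u v * z v = \sum_v
      (if v == u then (k u + (k u == 0)%:R) * z u else 0)
      - ap z u + k u * \sum_v k v * z v.
    rewrite mulr_sumr -sumrB -big_split; apply: eq_bigr => v _ /=.
    by rewrite /B eq_sym; case: eqP => [->|_]; ring.
  by rewrite -big_mkcond big_pred1_eq.
have [v Bv0 u|z Bz] := injective_system_solvable _ (fun u => k u * y u)
    (K := B).
  have : \sum_u v u * (\sum_j B u j * v j) = 0.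
    by apply: big1 => ? _; rewrite Bv0 mulr0.
  under eq_bigr do rewrite BE.
  (* Injectivity of [B]: pairing [v] with its image gives three nonnegative terms, which all vanish.
     They make [v] constant on the support of [k], zero off it, and of weighted sum zero. *)
  have -> : \sum_u v u * ((k u + (k u == 0)%:R) * v u - ap v u
        + k u * \sum_j k j * v j) =
      (\sum_u k u * v u ^+ 2 - \sum_u v u * ap v u)
      + (\sum_u (k u == 0)%:R * v u ^+ 2) + (\sum_u k u * v u) ^+ 2.
    rewrite [X in _ + X]expr2 [X in _ = _ + X]mulr_suml -sumrB -!big_split /=.
    by apply: eq_bigr => s _; ring.
  have L0 := laplacian_ge0 v; have S0 := sqr_ge0 (\sum_u k u * v u).
  have N0 s : 0 <= (k s == 0)%:R * v s ^+ 2 by rewrite mulr_ge0 ?sqr_ge0.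
  have /= T0 : 0 <= \sum_s (k s == 0)%:R * v s ^+ 2 by exact: sumr_ge0.
  move=> sum0.
  have Leq : \sum_u v u * ap v u = \sum_u k u * v u ^+ 2 by lra.
  have {S0} Seq : (\sum_u k u * v u) ^+ 2 = 0 by lra.
  have /psumr_eq0P/(_ u isT) Nu : \sum_s (k s == 0)%:R * v s ^+ 2 = 0 by lra.
  have [ku|ku] := eqVneq (k u) 0.
    have /eqP := Nu (fun s _ => N0 s).
    by rewrite ku eqxx mul1r sqrf_eq0 => /eqP.
  rewrite (laplacian_eq0 Leq ku).
  move/eqP: Seq; rewrite sqrf_eq0.
  have -> : \sum_s k s * v s = (\sum_s k s) * v o.
    rewrite mulr_suml; apply: eq_bigr => s _.
    have [->|ks] := eqVneq (k s) 0; first by rewrite !mul0r.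
    by rewrite (laplacian_eq0 Leq ks).
  rewrite mulf_eq0 => /orP[/eqP/psumr_eq0P k0|/eqP//].
  by rewrite k0 ?eqxx in ku.
exists z.
pose s := \sum_v k v * z v.
have apE u : ap z u = k u * (z u - y u) + k u * s.
  have := Bz u; rewrite BE; have [ku _|ku] := eqVneq (k u) 0.
    rewrite ku !mul0r addr0; apply: big1 => v _.
    by rewrite weight_eq0 ?mul0r.
  by rewrite -/s => E; rewrite mulrBr -E mulr0n; ring.
suff s0 : s = 0 by move=> u; rewrite apE s0 mulr0 addr0.
(* Sum [apE] over [u]: by symmetry [ap z] has total [s], and [y] has weighted sum 0. *)
have : s = s + (\sum_u k u) * s.
  rewrite {1}/s -ap_dot1; under eq_bigr do rewrite apE mulrBr.
  by rewrite big_split sumrB y0 subr0 -mulr_suml.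
move/eqP; rewrite eq_sym -subr_eq0 addrAC subrr add0r mulf_eq0.
by case/orP => /eqP // k0; exact: weighted_sum_eq0.
Qed.

(* The hypothesis says that the self-adjoint operator [A = D^-1 K] satisfies
   [A <= A^2], while [A <= 1] with equality only on constants; hence [A] has
   no eigenvalue in the open interval from 0 to 1 and is nonpositive on the
   orthogonal complement of the constants. *)
Lemma nonpos_on_mean_zero :
  (forall p, \sum_u p u * ap p u <= \sum_u ap p u ^+ 2 / k u) ->
  forall y, \sum_u k u * y u = 0 -> \sum_u y u * ap y u <= 0.
Proof.
move=> hyp y /laplacian_solvable[z apz].
(* On the support of [k], [y = z - A z]. With [a], [b], [c] below, [H1] amounts to [b <= a], and
   [H2] bounds the form at [y] by [b - a]. *)
have H1 := hyp z; have H2 := laplacian_ge0 (fun u => y u - z u).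
pose a := \sum_u k u * y u ^+ 2; pose b := \sum_u k u * (y u * z u).
pose c := \sum_u k u * z u ^+ 2.
have yz : \sum_u y u * ap z u = b - a.
  by rewrite -sumrB; apply: eq_bigr => u _; rewrite apz; ring.
have zz : \sum_u z u * ap z u = c - b.
  by rewrite -sumrB; apply: eq_bigr => u _; rewrite apz; ring.
have abc : \sum_u k u * (y u - z u) ^+ 2 = a - b *+ 2 + c.
  rewrite -sumrMnl -sumrB -big_split; apply: eq_bigr => u _ /=; ring.
have yy : \sum_u (y u - z u) * ap (fun u => y u - z u) u =
    \sum_u y u * ap y u - (b - a) *+ 2 + (c - b).
  have -> : (b - a) *+ 2 = \sum_u y u * ap z u + \sum_u z u * ap y u.
    by rewrite [X in _ = _ + X]ap_dotC yz mulr2n.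
  rewrite -zz opprD addrA.
  rewrite -!sumrB -big_split /=; apply: eq_bigr => u _ /=.
  rewrite [ap (fun _ => _) u](_ : _ = ap y u - ap z u); first by ring.
  by rewrite -sumrB; apply: eq_bigr => v _; ring.
have dd : \sum_u ap z u ^+ 2 / k u = a - b *+ 2 + c.
  rewrite -abc; apply: eq_bigr => u _; rewrite apz.
  have [->|ku] := eqVneq (k u) 0; first by rewrite !mul0r expr0n mul0r.
  by field.
move: H1 H2; rewrite zz dd abc yy; lra.
Qed.

End Laplacian.

(** The constant vector lies off the hyperplane [l = 0], so a multiple of [p] can be moved along it
    into the hyperplane, giving [y]. Multiplying the inequality at [y] by [q] and completing a
    square yields [(b q - a c)^2 <= a^2 (c^2 - qp q)]. *)
Lemma reverse_cauchy_schwarz (R : realFieldType) (I : finType)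
    (K : I -> I -> R) (l : I -> R) :
  (forall u v, K u v = K v u) ->
  0 < \sum_u \sum_v K u v -> \sum_u l u != 0 ->
  (forall y, \sum_u l u * y u = 0 ->
     \sum_u y u * (\sum_v K u v * y v) <= 0) ->
  forall p, (\sum_u p u * (\sum_v K u v * p v)) * (\sum_u \sum_v K u v)
    <= (\sum_u \sum_v K u v * p v) ^+ 2.
Proof.
move=> Ksym; set q := \sum_u \sum_v K u v => q_gt0.
set a := \sum_u l u => a_neq0 neg p.
set qp := \sum_u p u * _; set c := \sum_u \sum_v K u v * p v.
pose b := \sum_u l u * p u; pose y u := a * p u - b.
have c' : \sum_u p u * \sum_v K u v = c.
  under eq_bigr do rewrite mulr_sumr; rewrite exchange_big.
  apply: eq_bigr => u _; apply: eq_bigr => v _.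
  by rewrite Ksym mulrC.
have y0 : \sum_u l u * y u = 0.
  have -> : \sum_u l u * y u = \sum_u a * (l u * p u) - \sum_u l u * b.
    by rewrite -sumrB; apply: eq_bigr => u _; rewrite /y; ring.
  by rewrite -mulr_sumr -mulr_suml subrr.
have : a ^+ 2 * qp - (a * b * c) *+ 2 + b ^+ 2 * q <= 0.
  rewrite -[leLHS](_ : \sum_u y u * (\sum_v K u v * y v) = _) ?neg //.
  pose kp u := \sum_v K u v * p v; pose kk u := \sum_v K u v.
  have -> : (a * b * c) *+ 2 =
      a * b * (\sum_u p u * kk u) + a * b * c by rewrite c'; ring.
  rewrite -[qp]/(\sum_u p u * kp u) -[c]/(\sum_u kp u) -[q]/(\sum_u kk u).
  rewrite opprD addrA !mulr_sumr -!sumrB -big_split /=.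
  apply: eq_bigr => u _.
  have -> : \sum_v K u v * y v = a * kp u - b * kk u.
    by rewrite !mulr_sumr -sumrB; apply: eq_bigr => v _; rewrite /y; ring.
  by rewrite /y -mulr_sumr -/b; ring.
move=> H; have a2 : 0 < a ^+ 2 by rewrite lt_def sqr_ge0 sqrf_eq0 a_neq0.
rewrite -subr_ge0 -(pmulr_rge0 _ a2).
have := mulr_le0_ge0 H (ltW q_gt0); have := sqr_ge0 (b * q - a * c).
lra.
Qed.

(** * Independence families and their generating polynomials *)

Section IndepFamily.
Variable E : finType.
Implicit Types (X : {set {set E}}) (A B : {set E}) (e f : E) (u v : option E).

(* The empty family is allowed, so that links of loops need no special case. *)
Definition indep_family X :=
  (forall A B, A \subset B -> B \in X -> A \in X) /\
  (forall A B, A \in X -> B \in X -> (#|A| < #|B|)%N ->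
     exists2 x, x \in B :\: A & x |: A \in X).

(** The independent sets of the contraction by [e], or the empty family if [e] is a loop. *)
Definition link e X := [set A : {set E} | (e \notin A) && (e |: A \in X)].

(* [deriv v] is what the partial derivative in the variable indexed by [v]
   does to [X] in [gen_poly] below; [None] stands for the homogenizing
   variable. *)
Definition deriv v X := if v is Some e then link e X else X.

Lemma linkC e f X : link e (link f X) = link f (link e X).
Proof.
apply/setP => A; rewrite !inE !negb_or setUCA eq_sym.
by case: (f == e) (e \in A) (f \in A) => [] [] [] /=; rewrite ?andbF ?andbT.
Qed.

Lemma derivC u v X : deriv u (deriv v X) = deriv v (deriv u X).
Proof. by case: u v => [e|] [f|] //=; exact: linkC. Qed.

Lemma indep_family_deriv v X : indep_family X -> indep_family (deriv v X).
Proof.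
case: v => //= e [hX aX]; split=> [A B AB|A B].
  rewrite !inE => /andP[eB BX]; rewrite (contra (subsetP AB e) eB) /=.
  by apply: hX BX; apply: setUS.
rewrite !inE => /andP[eA AX] /andP[eB BX] ltAB.
have [|x] := aX _ _ AX BX; first by rewrite !cardsU1 eA eB.
rewrite !inE negb_or => /andP[/andP[xe xA] /predU1P[xe'|xB]] xX.
  by rewrite xe' eqxx in xe.
by exists x; rewrite !inE ?xA // negb_or eq_sym xe eA setUCA.
Qed.

Lemma indep_family_set0 X : indep_family X -> X != set0 -> set0 \in X.
Proof. by case=> hX _ /set0Pn[A]; apply: hX; exact: sub0set. Qed.

Lemma set0_link e X : (set0 \in link e X) = ([set e] \in X).
Proof. by rewrite inE in_set0 setU0. Qed.

Lemma set0_link2 e f X :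
  (set0 \in link e (link f X)) = (e != f) && ([set e; f] \in X).
Proof. by rewrite !inE setU0 setUC orbF eq_sym. Qed.

End IndepFamily.

Section GeneratingPolynomial.
Variables (R : realFieldType) (E : finType) (w : E -> R) (t : R).
Hypotheses (w_gt0 : forall e, 0 < w e) (t_gt0 : 0 < t).
Implicit Types (X : {set {set E}}) (A B : {set E}) (e f : E) (u v : option E).

(** Divided power of [t], so that differentiating in [t] only lowers [m]. The test [k <= m] matters:
    truncated subtraction would give 1 beyond it. *)
Definition div_pow (m k : nat) : R :=
  if (k <= m)%N then t ^+ (m - k) / (m - k)`!%:R else 0.

Lemma div_powSS m k : div_pow m.+1 k.+1 = div_pow m k.
Proof. by rewrite /div_pow ltnS subSS. Qed.

Lemma div_pow_ge0 m k : 0 <= div_pow m k.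
Proof.
by rewrite /div_pow; case: ifP => // _; rewrite divr_ge0 ?exprn_ge0 // ltW.
Qed.

Lemma div_powS m k :
  t * div_pow m k = (m.+1%:R - k%:R) * div_pow m.+1 k.
Proof.
rewrite /div_pow; case: (ltngtP k m.+1) => [||->].
- rewrite ltnS => lekm; rewrite lekm -natrB ?(leqW lekm) // subSn //.
  rewrite exprS factS natrM.
  have f0 : (m - k)`!%:R != 0 :> R by rewrite pnatr_eq0 -lt0n fact_gt0.
  have s0 : (m - k).+1%:R != 0 :> R by rewrite pnatr_eq0.
  by field; rewrite f0 nat1r.
- by move=> ltmk; rewrite leqNgt (ltn_trans _ ltmk) // !mulr0.
- by rewrite ltnn subrr mul0r mulr0.
Qed.

Definition gen_poly X m := \sum_(A in X) (\prod_(e in A) w e) * div_pow m #|A|.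

Lemma set_weight_gt0 A : 0 < \prod_(e in A) w e.
Proof. by apply: prodr_gt0 => e _. Qed.

Lemma gen_poly_term_ge0 A m : 0 <= (\prod_(e in A) w e) * div_pow m #|A|.
Proof. by rewrite mulr_ge0 ?div_pow_ge0 ?ltW ?set_weight_gt0. Qed.

Lemma gen_poly_ge0 X m : 0 <= gen_poly X m.
Proof. by apply: sumr_ge0 => A _; exact: gen_poly_term_ge0. Qed.

Lemma gen_poly_gt0 X m : set0 \in X -> 0 < gen_poly X m.
Proof.
move=> X0; rewrite /gen_poly (bigD1 set0) //= ltr_pwDl //; last first.
  by apply: sumr_ge0 => A _; exact: gen_poly_term_ge0.
rewrite big_set0 mul1r cards0 /div_pow leq0n subn0 divr_gt0 ?exprn_gt0 //.
by rewrite ltr0n fact_gt0.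
Qed.

Lemma gen_poly_set0 m : gen_poly set0 m = 0.
Proof. by rewrite /gen_poly big_set0. Qed.

Lemma gen_poly0 X : gen_poly X 0 = (set0 \in X)%:R.
Proof.
rewrite /gen_poly big_mkcond (bigD1 set0) //= [X in _ + X]big1 => [|A A0].
  case: (set0 \in X); rewrite addr0 // big_set0 cards0 mul1r /div_pow.
  by rewrite subn0 expr0 fact0 divr1.
case: ifP => // _; rewrite -(prednK (n := #|A|)) ?card_gt0 //.
by rewrite /div_pow mulr0.
Qed.

(** * Euler's identity and the Hessian of the generating polynomial *)

Definition om v := if v is Some e then w e else t.

Lemma om_gt0 v : 0 < om v. Proof. by case: v => /=. Qed.

Lemma big_option (F : option E -> R) :
  \sum_v F v = F None + \sum_e F (Some e).
Proof.
rewrite (bigD1 None) //=; congr (_ + _).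
rewrite (reindex_omap Some id) /=; last by case.
by apply: eq_bigl => e; rewrite eqxx.
Qed.

Lemma sum_link e X m :
  w e * gen_poly (link e X) m =
  \sum_(B in X | e \in B) (\prod_(f in B) w f) * div_pow m.+1 #|B|.
Proof.
rewrite [RHS](reindex_onto (fun A => e |: A) (fun B => B :\ e)) /=; last first.
  by move=> B /andP[_ eB]; exact: setD1K.
rewrite /gen_poly mulr_sumr; apply: eq_big => [A|A].
  rewrite !inE eqxx andbT andbC; congr (_ && _).
  apply/idP/eqP => [eA|<-]; last by rewrite !inE eqxx.
  by rewrite setU1K.
by rewrite inE => /andP[eA _]; rewrite big_setU1 // cardsU1 eA div_powSS mulrA.
Qed.

(** A set [A] is counted [#|A|] times through its elements and [m.+1 - #|A|] times through [t]. *)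
Lemma euler X m :
  \sum_v om v * gen_poly (deriv v X) m = m.+1%:R * gen_poly X m.+1.
Proof.
rewrite big_option /=; under [X in _ + X]eq_bigr do rewrite sum_link.
rewrite /gen_poly (exchange_big_dep (mem X)) /=; last by move=> ? ? _ /andP[].
rewrite !mulr_sumr -big_split; apply: eq_bigr => A AX /=.
rewrite AX /= sumr_const mulrCA div_powS -[_ *+ #|A|]mulr_natl; ring.
Qed.

(* The Hessian of [gen_poly] in logarithmic coordinates, so that the Euler
   vector becomes the constant vector 1. *)
Definition hess X m u v :=
  om u * om v * gen_poly (deriv u (deriv v X)) m.

Lemma hessC X m u v : hess X m u v = hess X m v u.
Proof. by rewrite /hess derivC (mulrC (om u)). Qed.

Lemma hess_ge0 X m u v : 0 <= hess X m u v.
Proof. by rewrite !mulr_ge0 ?gen_poly_ge0 // ltW ?om_gt0. Qed.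

Lemma hess_row X m u :
  \sum_v hess X m u v = m.+1%:R * (om u * gen_poly (deriv u X) m.+1).
Proof.
rewrite mulrCA -euler mulr_sumr; apply: eq_bigr => v _.
by rewrite /hess derivC mulrA.
Qed.

Lemma hess_sum X m :
  \sum_u \sum_v hess X m u v = m.+1%:R * (m.+2%:R * gen_poly X m.+2).
Proof.
by rewrite -euler mulr_sumr; apply: eq_bigr => u _; rewrite hess_row.
Qed.

Lemma hess_deriv X m a b :
  \sum_v om v * hess (deriv v X) m a b = m.+1%:R * hess X m.+1 a b.
Proof.
rewrite /hess mulrCA -euler mulr_sumr; apply: eq_bigr => v _.
by rewrite (derivC b) (derivC a); ring.
Qed.

(** The Hessian of a derivative sends the constant vector to a multiple of row [v] of the full
    Hessian; this turns the induction hypothesis into [A <= A^2]. *)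
Lemma hess_deriv_row X m v a :
  om v * \sum_b hess (deriv v X) m a b = m.+1%:R * hess X m.+1 v a.
Proof. by rewrite hess_row /hess derivC; ring. Qed.

Lemma hess_deriv_sum X m v :
  om v * \sum_a \sum_b hess (deriv v X) m a b =
  m.+1%:R * \sum_a hess X m.+1 v a.
Proof.
by rewrite !mulr_sumr; apply: eq_bigr => a _; rewrite hess_deriv_row.
Qed.

(** The Hodge-Riemann property as a reverse Cauchy-Schwarz inequality against the constant vector;
    without division it also covers a zero Hessian. Here [m] is the degree of the entries, so the
    polynomial is [gen_poly X m.+2]. *)
Definition hyperbolic X m := forall p : option E -> R,
  (\sum_u p u * (\sum_v hess X m u v * p v)) * (\sum_u \sum_v hess X m u v)
  <= (\sum_u \sum_v hess X m u v * p v) ^+ 2.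

Lemma deriv_set0 v : deriv v (set0 : {set {set E}}) = set0.
Proof. by case: v => //= e; apply/setP => A; rewrite !inE andbF. Qed.

Lemma hyperbolic_set0 m : hyperbolic set0 m.
Proof.
move=> p; rewrite [X in _ * X]big1 ?mulr0 ?sqr_ge0 // => u _.
by apply: big1 => v _; rewrite /hess !deriv_set0 gen_poly_set0 mulr0.
Qed.

(** Grouping by the value of [c] gives a sum of squares of class sums. *)
Lemma class_form_ge0 (T : finType) (c : E -> T) (P : pred E) (y : E -> R) :
  0 <= \sum_(e | P e) \sum_(f | P f) (c e == c f)%:R * (y e * y f).
Proof.
suff -> : \sum_(e | P e) \sum_(f | P f) (c e == c f)%:R * (y e * y f) =
    \sum_s (\sum_(e | P e && (c e == s)) y e) ^+ 2.
  by apply: sumr_ge0 => s _; exact: sqr_ge0.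
rewrite (partition_big c predT) //=; apply: eq_bigr => s _.
rewrite expr2 mulr_suml; apply: eq_bigr => e /andP[_ /eqP ces].
rewrite mulr_sumr [RHS]big_mkcondr; apply: eq_bigr => f _.
by rewrite ces eq_sym; case: ifP; rewrite ?mul1r ?mul0r.
Qed.

(* For degree 2, the Hessian is a square of a linear form minus the sum of
   squares of linear forms given by the parallel classes. *)
Lemma hyperbolic0 X : indep_family X -> set0 \in X -> hyperbolic X 0.
Proof.
move=> [hX aX] X0.
pose nl e := [set e] \in X.
pose par e f := [set e; f] \notin X.
pose c e := [set f | nl f && ((f == e) || par e f)].
have parC e f : par e f = par f e by rewrite /par setUC.
(* If [{e, g}] were independent, augmenting [{f}] from it would make [{e, f}] or [{f, g}]
   independent. *)
have par_trans e f g : nl f -> e != g -> par e f -> par f g -> par e g.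
  move=> nlf eg pef pfg; apply/negP => egX.
  have [|x] := aX _ _ nlf egX; first by rewrite cards1 cards2 eg.
  rewrite !inE => /andP[_ /orP[]/eqP->] xX.
    by rewrite /par xX in pef.
  by rewrite parC /par xX in pfg.
have cE e f : nl e -> nl f -> (c e == c f) = (e == f) || par e f.
  move=> nle nlf; apply/eqP/idP => [/setP/(_ f)|/orP[/eqP->//|pef]].
    by rewrite !inE nlf eqxx /= eq_sym.
  apply/setP => g; rewrite !inE; case nlg : (nl g) => //=.
  have [->|ge] := eqVneq g e; first by rewrite /= parC pef orbT.
  have [->|gf] := eqVneq g f; first by rewrite pef.
  apply/idP/idP; rewrite ?orFb.
    by move=> peg; apply: (par_trans _ e) => //; [rewrite eq_sym | rewrite parC].
  by move=> pfg; apply: (par_trans _ f) => //; rewrite eq_sym.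
pose l v := om v * (if v is Some e then (nl e)%:R else 1).
have l_ge0 v : 0 <= l v.
  by apply: mulr_ge0; [exact/ltW/om_gt0 | case: v].
have hessE u v : hess X 0 u v = l u * l v - (if (u, v) is (Some e, Some f)
    then (nl e && nl f && (c e == c f))%:R * (w e * w f) else 0).
  rewrite /hess gen_poly0 /l; case: u v => [e|] [f|] /=.
  - rewrite set0_link2.
    case nle : (nl e); case nlf : (nl f) => /=; first last.
    + rewrite (_ : _ \in X = false) ?andbF /=; first by ring.
      apply: contraFF nle; apply: hX; apply/subsetP => g.
      by rewrite !inE => ->.
    + rewrite (_ : _ \in X = false) ?andbF /=; first by ring.
      apply: contraFF nle; apply: hX; apply/subsetP => g.
      by rewrite !inE => ->.
    + rewrite (_ : _ \in X = false) ?andbF /=; first by ring.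
      apply: contraFF nlf; apply: hX; apply/subsetP => g.
      by rewrite !inE => ->; rewrite orbT.
    rewrite cE // /par; case: (e == f) => /=; first by ring.
    by case: (_ \in X) => /=; ring.
  - by rewrite set0_link -/(nl e); ring.
  - by rewrite set0_link -/(nl f); ring.
  - by rewrite X0 /=; ring.
apply: (reverse_cauchy_schwarz (l := l)).
- exact: hessC.
- by rewrite hess_sum !mulr_gt0 ?ltr0n ?gen_poly_gt0.
- rewrite gt_eqF // (bigD1 None) //= ltr_pwDl ?sumr_ge0 //.
  by rewrite /l /= mulr1.
move=> y y0.
have -> : \sum_u y u * (\sum_v hess X 0 u v * y v) =
    (\sum_u l u * y u) * (\sum_u l u * y u) -
    \sum_(e | nl e) \sum_(f | nl f)
      (c e == c f)%:R * ((w e * y (Some e)) * (w f * y (Some f))).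
  have -> : \sum_(e | nl e) \sum_(f | nl f)
      (c e == c f)%:R * ((w e * y (Some e)) * (w f * y (Some f))) =
    \sum_u \sum_v (if (u, v) is (Some e, Some f)
      then (nl e && nl f && (c e == c f))%:R * (w e * w f) else 0)
      * (y u * y v).
    rewrite big_option [X in _ = X + _]big1 ?add0r => [|v _]; last by rewrite mul0r.
    rewrite big_mkcond; apply: eq_bigr => e _.
    rewrite big_option mul0r add0r; case: (nl e) => /=; last first.
      by rewrite big1 // => f _; rewrite !mul0r.
    rewrite big_mkcond; apply: eq_bigr => f _.
    by case: (nl f) => /=; ring.
  rewrite mulr_suml -sumrB; apply: eq_bigr => u _.
  rewrite !mulr_sumr -sumrB; apply: eq_bigr => v _.
  by rewrite hessE; case: u v => [e|] [f|]; ring.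
by rewrite y0 mul0r add0r oppr_le0; exact: class_form_ge0.
Qed.

Lemma gen_poly_hyperbolic X m : indep_family X -> hyperbolic X m.
Proof.
elim: m X => [|m IHm] X iX;
    have [->|/(indep_family_set0 iX) X0] := eqVneq X set0;
    try exact: hyperbolic_set0.
  exact: hyperbolic0.
pose k u := \sum_v hess X m.+1 u v.
have k_neq0 u : k u != 0 -> set0 \in deriv u X.
  move=> ku; apply: indep_family_set0; first exact: indep_family_deriv.
  apply: contraNneq ku => Xu0.
  by rewrite /k hess_row Xu0 gen_poly_set0 !mulr0.
have Kk : 0 < \sum_u k u.
  by rewrite hess_sum !mulr_gt0 ?ltr0n ?gen_poly_gt0.
apply: (reverse_cauchy_schwarz (l := k)) => //; first exact: hessC.
  by rewrite gt_eqF.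
(* [None] is the centre of the star: [deriv None] keeps the family, so its entry against [u] is
   positive once [deriv u X] is nonempty. *)
apply: (nonpos_on_mean_zero (hessC X m.+1) (hess_ge0 X m.+1) (o := None)) => //.
  by move=> u /k_neq0 Xu; rewrite /hess !mulr_gt0 ?om_gt0 ?gen_poly_gt0.
move=> p.
have m0 : 0 < m.+1%:R :> R by rewrite ltr0n.
pose q v := \sum_a p a * (\sum_b hess (deriv v X) m a b * p b).
have -> : \sum_u p u * (\sum_v hess X m.+1 u v * p v) =
    \sum_v om v * q v / m.+1%:R.
  apply: (mulfI (lt0r_neq0 m0)); rewrite -mulr_suml [RHS]mulrC divfK ?lt0r_neq0 //.
  under [RHS]eq_bigr do rewrite /q mulr_sumr.
  rewrite exchange_big mulr_sumr; apply: eq_bigr => a _ /=.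
  under [RHS]eq_bigr do rewrite mulrCA mulr_sumr.
  rewrite -mulr_sumr exchange_big mulrCA mulr_sumr; congr (_ * _).
  apply: eq_bigr => b _; rewrite mulrA -hess_deriv mulr_suml.
  by apply: eq_bigr => v _; rewrite -mulrA.
apply: ler_sum => v _; rewrite -/(k v).
(* Here the right side is 0 by the convention for [0^-1], and the left side is 0 because [deriv v X]
   is empty. *)
have [kv0|kv] := eqVneq (k v) 0.
  rewrite kv0 invr0 mulr0 /q big1 ?mulr0 ?mul0r // => a _.
  rewrite big1 ?mulr0 // => b _; rewrite /hess.
  suff -> : deriv v X = set0 by rewrite !deriv_set0 gen_poly_set0 mulr0 mul0r.
  apply/eqP; apply: contraTT isT => /indep_family_set0 Xv.
  have := Xv (indep_family_deriv v iX) => /(@gen_poly_gt0 _ m.+2) Fv.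
  move: kv0; rewrite /k hess_row => /eqP.
  by rewrite gt_eqF // !mulr_gt0 ?om_gt0.
have kv_gt0 : 0 < k v by rewrite lt_def kv sumr_ge0 // => u _; exact: hess_ge0.
(* The hypothesis reads [q v * S2 <= S1 ^+ 2]; up to scalars [S2] is [k v] and [S1] is the
   coordinate [v] of the Hessian applied to [p]. *)
have := IHm _ (indep_family_deriv v iX) p; rewrite -/(q v).
set S2 := \sum_u \sum_v _; set S1 := \sum_u \sum_v _ => Hq.
have S2E : om v * S2 = m.+1%:R * k v by exact: hess_deriv_sum.
have S1E : om v * S1 = m.+1%:R * \sum_a hess X m.+1 v a * p a.
  rewrite /S1 exchange_big !mulr_sumr; apply: eq_bigr => a _ /=.
  rewrite -mulr_suml; under eq_bigr do rewrite hessC.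
  by rewrite mulrA hess_deriv_row mulrA.
rewrite ler_pdivlMr // -(ler_pM2l m0) -(ler_pM2l m0).
have -> : m.+1%:R * (m.+1%:R * (\sum_a hess X m.+1 v a * p a) ^+ 2) =
  (om v * S1) ^+ 2 by rewrite S1E; ring.
have -> : m.+1%:R * (m.+1%:R * (om v * q v / m.+1%:R * k v)) =
    om v * q v * (m.+1%:R * k v) by field; rewrite nat1r lt0r_neq0.
rewrite -S2E exprMn.
have -> : om v * q v * (om v * S2) = om v ^+ 2 * (q v * S2) by ring.
by rewrite ler_wpM2l ?sqr_ge0.
Qed.

(** Hyperbolicity at the coordinate vector of [t]: the three quantities become the second and first
    derivatives in [t] and the polynomial itself. *)
Lemma gen_poly_ultra_log_concave X m : indep_family X ->
  m.+2%:R * (gen_poly X m * gen_poly X m.+2) <=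
  m.+1%:R * gen_poly X m.+1 ^+ 2.
Proof.
move=> iX; pose p v : R := (v == None)%:R.
have sump (F : option E -> R) : \sum_v F v * p v = F None.
  by rewrite big_option big1 ?addr0 /p ?mulr1 // => e _; rewrite mulr0.
have := gen_poly_hyperbolic m iX p.
have -> : \sum_u \sum_v hess X m u v * p v = m.+1%:R * (t * gen_poly X m.+1).
  under eq_bigr do rewrite sump hessC; exact: hess_row.
under eq_bigr do rewrite sump mulrC.
rewrite sump hess_sum /hess /= => H.
have m0 : 0 < m.+1%:R * t ^+ 2 :> R by rewrite mulr_gt0 ?ltr0n ?exprn_gt0.
by rewrite -(ler_pM2l m0); move: H; congr (is_true (_ <= _)); ring.
Qed.

End GeneratingPolynomial.

(** * Mason's inequality *)

Section Mason.
Variables (R : realFieldType) (E : finType) (w : E -> R).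
Hypothesis w_gt0 : forall e, 0 < w e.

Definition level_sum (X : {set {set E}}) k :=
  \sum_(A in X | #|A| == k) \prod_(e in A) w e.

Lemma level_sum_ge0 X k : 0 <= level_sum X k.
Proof. by apply: sumr_ge0 => A _; rewrite ltW ?set_weight_gt0. Qed.

Lemma level_sum_le_gen_poly (t : R) X m :
  0 < t -> level_sum X m <= gen_poly w t X m.
Proof.
move=> t0; rewrite /level_sum big_mkcondr; apply: ler_sum => A _.
case: eqP => [->|_]; last exact: gen_poly_term_ge0.
by rewrite /div_pow leqnn subnn expr0 fact0 divr1 mulr1.
Qed.

(** Sets smaller than [m] carry a factor [t], and for [t <= 1] the remaining powers are at most
    1. *)
Lemma gen_poly_le_level_sum (t : R) X m : 0 < t -> t <= 1 ->
  gen_poly w t X m <= level_sum X m + t * gen_poly w 1 X m.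
Proof.
move=> t0 t1; rewrite /level_sum big_mkcondr /gen_poly mulr_sumr -big_split.
apply: ler_sum => A _ /=; have wA := set_weight_gt0 w_gt0 A.
rewrite mulrCA /div_pow; case: (ltngtP #|A| m) => [ltAm|_|->].
- rewrite add0r ler_pM2l // expr1n mulrA mulr1 ler_pM2r ?invr_gt0 ?ltr0n ?fact_gt0 //.
  by rewrite -subnSK // exprS ler_piMr ?(ltW t0) // exprn_ile1 // ltW.
- by rewrite !mulr0 addr0.
- by rewrite subnn !expr0 fact0 divr1 !mulr1 lerDl mulr_ge0 ?ltW.
Qed.

Lemma level_sum_ultra_log_concave X m : indep_family X ->
  m.+2%:R * (level_sum X m * level_sum X m.+2) <=
  m.+1%:R * level_sum X m.+1 ^+ 2.
Proof.
move=> iX; set L := level_sum X m.+1.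
have L0 : 0 <= L by exact: level_sum_ge0.
have C0 : 0 <= gen_poly w 1 X m.+1 by exact: gen_poly_ge0.
set C := gen_poly w 1 X m.+1 in C0.
have bound (t : R) : 0 < t -> t <= 1 ->
    m.+2%:R * (level_sum X m * level_sum X m.+2) <=
    m.+1%:R * L ^+ 2 + t * (m.+1%:R * (L * C *+ 2 + C ^+ 2)).
  move=> t0 t1; have H := gen_poly_ultra_log_concave w_gt0 t0 m iX.
  apply: le_trans (le_trans _ H) _.
    by rewrite ler_wpM2l // ler_pM ?level_sum_ge0 ?level_sum_le_gen_poly.
  have -> : m.+1%:R * L ^+ 2 + t * (m.+1%:R * (L * C *+ 2 + C ^+ 2)) =
     m.+1%:R * (L ^+ 2 + t * (L * C *+ 2 + C ^+ 2)) by ring.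
  rewrite ler_wpM2l //; apply: (@le_trans _ _ ((L + t * C) ^+ 2)).
    rewrite ler_pXn2r ?nnegrE ?gen_poly_ge0 ?gen_poly_le_level_sum //.
    by rewrite addr_ge0 ?mulr_ge0 ?(ltW t0).
  have : 0 <= t * C ^+ 2 * (1 - t).
    by rewrite !mulr_ge0 ?subr_ge0 ?sqr_ge0 ?(ltW t0).
  lra.
set N := m.+1%:R * (L * C *+ 2 + C ^+ 2) in bound.
apply/ler_addgt0Pr => e e0.
have N0 : 0 <= N by rewrite mulr_ge0 ?addr_ge0 ?mulrn_wge0 ?mulr_ge0 ?sqr_ge0.
have eN : 0 < e + N by lra.
(* This [t] lies in the interval from 0 to 1 and satisfies [t * N <= e], even if [N] is 0. *)
apply: le_trans (bound (e / (e + N)) _ _) _.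
- by rewrite divr_gt0.
- by rewrite ler_pdivrMr // mul1r; lra.
- by rewrite lerD2l mulrAC ler_pdivrMr // ler_pM2l //; lra.
Qed.

End Mason.

(** * Matroids *)

Section Matroid.
Variables (E : finType) (M : matroid E).
Implicit Types A B b : {set E}.

Lemma indep_card A : indep M A -> (#|A| <= matroid_rank M)%N.
Proof.
case/existsP => b /andP[Mb Ab]; rewrite -(card_basis Mb).
exact: subset_leq_card.
Qed.

Lemma indepS A B : A \subset B -> indep M B -> indep M A.
Proof.
move=> AB /existsP[b /andP[Mb Bb]]; apply/existsP; exists b.
by rewrite Mb (subset_trans AB).
Qed.

Lemma indep_full A : indep M A -> #|A| = matroid_rank M -> A \in bases M.
Proof.
case/existsP => b /andP[Mb Ab] cA; suff -> : A = b by [].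
by apply/eqP; rewrite eqEcard Ab cA (card_basis Mb) leqnn.
Qed.

Lemma basis_indep b : b \in bases M -> indep M b.
Proof. by move=> Mb; apply/existsP; exists b; rewrite Mb subxx. Qed.

(** Start from a basis containing [A] and exchange its elements outside [A :|: b] for elements of
    [b]; [#|a :\: b|] drops each time. *)
Lemma indep_basis_near A b : indep M A -> b \in bases M ->
  exists a, [/\ a \in bases M, A \subset a & a \subset A :|: b].
Proof.
move=> /existsP[a /andP[Ma Aa]] Mb.
have [n] := ubnP #|a :\: b|; elim: n a Ma Aa => // n IHn a Ma Aa lt_n.
have [sub|/subsetPn[x xa]] := boolP (a \subset A :|: b); first by exists a.
rewrite inE negb_or => /andP[xA xb].
have [|y] := bases_exchange Ma Mb (x := x); first by rewrite inE xa xb.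
rewrite inE => /andP[ya yb] Ma'.
apply: IHn Ma' _ _.
  apply/subsetP => z zA; rewrite !inE (subsetP Aa) // andbT.
  by rewrite (memPn xA) ?orbT.
rewrite ltnS in lt_n; apply: leq_trans lt_n; apply: proper_card.
apply/properP; split.
  apply/subsetP => z; rewrite !inE => /andP[zb /predU1P[zy|/andP[_ ->]]].
    by rewrite zy yb in zb.
  by rewrite zb.
exists x; rewrite !inE ?xb ?xa // eqxx orbF.
by apply: contraNneq xb => ->; rewrite yb.
Qed.

(** Take a basis [a] between [A] and [A :|: b], with [b] a basis containing [B]. If [a] met [B] only
    inside [A], then [a :\: A] would lie in [b :\: B], forcing [#|B| <= #|A|]. *)
Lemma indep_augment A B : indep M A -> indep M B -> (#|A| < #|B|)%N ->
  exists2 x, x \in B :\: A & indep M (x |: A).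
Proof.
move=> iA /existsP[b /andP[Mb Bb]] ltAB.
have [a [Ma Aa ab]] := indep_basis_near iA Mb.
have [sub|/subsetPn[x]] := boolP (B :&: a \subset A); last first.
  rewrite inE => /andP[xB xa] xA; exists x; first by rewrite inE xA.
  by apply/existsP; exists a; rewrite Ma subUset sub1set xa.
have := subset_leq_card (_ : a :\: A \subset b :\: B).
rewrite !cardsDS // (card_basis Ma) (card_basis Mb) => H.
have /H : a :\: A \subset b :\: B.
  apply/subsetP => x; rewrite !inE => /andP[xA xa].
  have := subsetP ab x xa; rewrite inE (negbTE xA) /= => ->.
  by rewrite andbT; apply: contra xA => xB; apply: (subsetP sub); rewrite inE xB.
have := subset_leq_card Bb; rewrite (card_basis Mb).
have := indep_card iA; lia.
Qed.

Lemma indep_family_restrict (S : {set E}) :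
  indep_family [set A | indep M A & A \subset S].
Proof.
split=> [A B AB|A B]; rewrite !inE.
  by case/andP=> iB BS; rewrite (indepS AB) // (subset_trans AB).
move=> /andP[iA AS] /andP[iB BS] /(indep_augment iA iB)[x xBA ixA].
exists x => //; rewrite inE ixA subUset AS sub1set andbT.
by move: xBA; rewrite inE => /andP[_ xB]; exact: subsetP BS x xB.
Qed.

(** Otherwise [e |: A] contains a circuit; it passes through [e], as [A] is independent, yet is too
    small for a free element. *)
Lemma free_extend A e : free_element M e -> e \notin A -> indep M A ->
  (#|A|.+1 = matroid_rank M)%N -> e |: A \in bases M.
Proof.
move=> [_ fe] eA iA cA.
have ceA : #|e |: A| = matroid_rank M by rewrite cardsU1 eA.
apply: indep_full => //; apply: contraT.
move=> /(@minset_exists _ (fun B => ~~ indep M B))[C circC CeA].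
have eC : e \in C.
  apply: contraT => eC; have := minsetp circC.
  rewrite (indepS _ iA) //; apply/subsetP => x xC.
  have := subsetP CeA x xC; rewrite !inE => /predU1P[xe|//].
  by rewrite -xe xC in eC.
have := subset_leq_card CeA; rewrite (fe C circC eC) ceA; lia.
Qed.

Lemma basis_probE (R : realType) (w : E -> R) (P : pred {set E}) :
  basis_prob M w P = (\sum_(b in bases M | P b) basis_weight w b) /
    \sum_(b in bases M) basis_weight w b.
Proof.
rewrite /basis_prob /basis_pmf -big_mkcondr mulr_suml.
by apply: eq_bigl => b; rewrite andbC.
Qed.

End Matroid.

Theorem theorem1p6 (R : realType) (E : finType) (M : matroid E) (d : nat)
    (rankM : matroid_rank M = d) (d_gt0 : (0 < d)%N)
    (w : E -> R) (w_gt0 : forall e : E, 0 < w e)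
    (i j : E) (neq_ij : i <> j)
    (free_i : free_element M i) (free_j : free_element M j) :
  basis_prob M w (fun b => (i \in b) && (j \in b)) *
  basis_prob M w (fun b => (i \notin b) && (j \notin b))
  <= (1 - 1 / d%:R) *
     basis_prob M w (fun b => (i \in b) && (j \notin b)) *
     basis_prob M w (fun b => (i \notin b) && (j \in b)).
Proof.
have wt_gt0 b : 0 < basis_weight w b by exact: set_weight_gt0.
pose T P := \sum_(b in bases M | P b) basis_weight w b.
have T_ge0 P : 0 <= T P by apply: sumr_ge0 => b _; exact: ltW.
rewrite !basis_probE -!/(T _); set Z := \sum_(b in bases M) _.
have Z_ge0 : 0 <= Z^-1 by rewrite invr_ge0 sumr_ge0 // => b _; exact: ltW.
set Tij := T _; set T0 := T _; set Ti := T _; set Tj := T _.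
suff H : Tij * T0 <= (1 - 1 / d%:R) * (Ti * Tj).
  have -> : Tij / Z * (T0 / Z) = Tij * T0 * Z^-1 ^+ 2 by ring.
  have -> : (1 - 1 / d%:R) * (Ti / Z) * (Tj / Z) =
    (1 - 1 / d%:R) * (Ti * Tj) * Z^-1 ^+ 2 by ring.
  by rewrite ler_wpM2r ?sqr_ge0.
have ij : i != j by exact/eqP.
(* In rank 1 no basis contains both [i] and [j], and [1 - 1 / d] is 0. Otherwise [d = m.+2], and
   Mason's inequality is used at level [m]. *)
case: d rankM d_gt0 => // -[|m] rankM _.
  rewrite [Tij]big1 => [|b /and3P[Mb ib jb]].
    by rewrite mul0r divr1 subrr mul0r.
  have := subset_leq_card (_ : [set i; j] \subset b).
  by rewrite cards2 ij (card_basis Mb) rankM subUset !sub1set ib jb => /(_ isT).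
pose X := [set A | indep M A & A \subset ~: [set i; j]].
have X_avoid A : (A \in X) = [&& indep M A, i \notin A & j \notin A].
  by rewrite inE subsetC subUset !sub1set !inE.
have T0E : T0 <= level_sum w X m.+2.
  rewrite /T0 /T /level_sum big_mkcond [leRHS]big_mkcond.
  apply: ler_sum => b _; rewrite X_avoid -andbA.
  have [/and3P[Mb ib jb]|_] := ifP.
    by rewrite basis_indep // ib jb (card_basis Mb) rankM eqxx.
  by case: ifP => // _; exact/ltW/wt_gt0.
(* Freeness enters here: adding [e] to any member of [X] of size [m.+1] gives a basis avoiding
   [f]. *)
have TiE e f : e != f -> free_element M e ->
    [set e; f] = [set i; j] ->
    w e * level_sum w X m.+1 <= T (fun b => (e \in b) && (f \notin b)).
  move=> ef fe efE.
  have Xef A : (A \in X) = [&& indep M A, e \notin A & f \notin A].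
    by rewrite inE -efE subsetC subUset !sub1set !inE.
  rewrite /T (reindex_onto (fun A => e |: A) (fun b => b :\ e)) /=; last first.
    by move=> b /and3P[_ eb _]; exact: setD1K.
  rewrite /level_sum mulr_sumr big_mkcond [leRHS]big_mkcond.
  apply: ler_sum => A _; rewrite Xef.
  have [/andP[/and3P[iA eA fA] /eqP cA]|_] := ifP; last first.
    by case: ifP => // _; exact/ltW/wt_gt0.
  rewrite free_extend ?cA // !inE eqxx /= eq_sym (negbTE ef) /= fA setU1K //.
  by rewrite eqxx /basis_weight big_setU1.
have TijE : Tij <= w i * w j * level_sum w X m.
  rewrite /Tij /T (reindex_onto (fun A => i |: (j |: A))
    (fun b => (b :\ i) :\ j)) /=; last first.
    by move=> b /and3P[_ ib jb]; rewrite setD1K ?setD1K // !inE eq_sym ij.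
  rewrite /level_sum mulr_sumr big_mkcond [leRHS]big_mkcond.
  apply: ler_sum => A _; rewrite X_avoid.
  have [/andP[/and3P[MA _ _] /eqP AE]|_] := ifP; last first.
    by case: ifP => // _; rewrite !mulr_ge0 ?ltW ?set_weight_gt0.
  have iA : i \notin A by rewrite -AE !inE eqxx andbF.
  have jA : j \notin A by rewrite -AE !inE eqxx.
  have ijA : i \notin j |: A by rewrite !inE negb_or ij.
  rewrite iA jA (indepS _ (basis_indep MA)) /=; last first.
    by apply/subsetP => x xA; rewrite !inE xA !orbT.
  have := card_basis MA; rewrite rankM !cardsU1 ijA jA !add1n => -[->].
  by rewrite eqxx /basis_weight !big_setU1 //= mulrA.
have iX : indep_family X by exact: indep_family_restrict.
have H := level_sum_ultra_log_concave w_gt0 m iX.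
set L0 := level_sum w X m in H TijE; set L1 := level_sum w X m.+1 in H TiE.
set L2 := level_sum w X m.+2 in H T0E.
have Ti_ge : w i * L1 <= Ti by exact: TiE.
have Tj_ge : w j * L1 <= Tj.
  rewrite (_ : Tj = T (fun b => (j \in b) && (i \notin b))).
    by apply: TiE => //; rewrite 1?eq_sym // setUC.
  by apply: eq_bigl => b; rewrite [in RHS](andbC (j \in b)).
have m2 : 0 < m.+2%:R :> R by rewrite ltr0n.
have dE : 1 - 1 / m.+2%:R = m.+1%:R / m.+2%:R :> R.
  have -> : m.+1%:R = m.+2%:R - 1 :> R by rewrite -[m.+2%:R]natr1 addrK.
  by rewrite mulrBl divff ?gt_eqF.
rewrite dE mulrAC ler_pdivlMr //.
apply: le_trans (_ : w i * w j * L0 * L2 * m.+2%:R <= _).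
  by rewrite ler_wpM2r // ler_pM ?T_ge0.
apply: le_trans (_ : m.+1%:R * ((w i * L1) * (w j * L1)) <= _).
  have := ler_wpM2l (ltW (mulr_gt0 (w_gt0 i) (w_gt0 j))) H.
  by move=> {}H; apply: le_trans (le_trans _ H) _; rewrite le_eqVlt;
    apply/orP; left; apply/eqP; ring.
have L1_ge0 : 0 <= L1 by exact: level_sum_ge0.
by rewrite ler_wpM2l // ler_pM // mulr_ge0 // ltW.
Qed.
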